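(* For every $n\in\mathbb N$ there are non-isomorphic (possibly vertex- and edge-coloured) graphs $G_n$, $\tilde G_n$ of size $O(n)$ (i.e. there is a constant $c$, independent of $n$, such that $G_n$ and $\tilde G_n$ each have at most $cn$ vertices plus edges) such that: 1. for every field $\mathbb F$ of characteristic $\neq 2$, there is no degree-$n$ polynomial calculus refutation of $\mathsf P_{\mathrm{iso}}(G_n,\tilde G_n)$ over $\mathbb F$; 2. there is no degree-$n$ Positivstellensatz calculus refutation of $\mathsf P_{\mathrm{iso}}(G_n,\tilde G_n)$ over the reals.
   Context: Polynomial calculus (PC) over a field $\mathbb F$: given a set $\mathsf P$ of polynomials over $\mathbb F$ (each $p$ standing for the equation $p=0$), a PC derivation from $\mathsf P$ is a sequence of polynomials each of which is either an axiom (an element of $\mathsf P$, or $x^2-x$ for a variable $x$), or obtained from an earlier polynomial $f$ by the multiplication rule (derive $xf$ for a variable $x$), or from earlier $g,f$ by linear combination (derive $ag+bf$, $a,b\in\mathbb F$). A refutation is a derivation of the constant polynomial $1$. The degree of a derivation is the maximum degree of a polynomial in it. A Positivstellensatz calculus refutation of $\mathsf P$ is a PC derivation over $\mathbb R$ from $\mathsf P$ of a polynomial of the form $1+\sum_i h_i^2$ with real polynomials $h_i$; its degree is the maximum degree of every polynomial in the derivation. Graphs may have coloured vertices and/or edges; isomorphisms are required to preserve colours. A local isomorphism from $G$ to $H$ is an injective map $\pi$ with domain contained in $V(G)$ and range in $V(H)$ (viewed as a subset of $V(G)\times V(H)$) such that $vv'\in E(G)\iff \pi(v)\pi(v')\in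 E(H)$ for all $v,v'$ in its domain, and which preserves vertex and edge colours. Standing assumption: $|V(G)|\ge 2$ or $|V(H)|\ge 2$. The system $\mathsf P_{\mathrm{iso}}(G,H)$ in variables $x_{vw}$ ($v\in V(G)$, $w\in V(H)$) consists of: $\sum_{v\in V(G)}x_{vw}-1$ for all $w\in V(H)$; $\sum_{w\in V(H)}x_{vw}-1$ for all $v\in V(G)$; and $x_{vw}x_{v'w'}$ for all $v,v'\in V(G)$, $w,w'\in V(H)$ such that $\{(v,w),(v',w')\}$ is not a local isomorphism. *)

(* Defs.v *)
(* "The reals" are an arbitrary realType: a complete Archimedean ordered field. *)
From HB Require Import structures.
From mathcomp Require Import all_boot all_order all_algebra.
From mathcomp Require Import reals.
From mathcomp Require Import mpoly.

Set Implicit Arguments.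
Unset Strict Implicit.
Unset Printing Implicit Defensive.

Import GRing.Theory.
Local Open Scope ring_scope.

(* Finite simple undirected graphs with coloured vertices and edges, colours
   being natural numbers; an uncoloured graph has constant colourings.  The
   values of [ecol] outside [edges] are junk and are never inspected. *)
Record cgraph : Type := CGraph {
  vertex :> finType;
  edges : {set {set vertex}};
  edges_card2 : forall e : {set vertex}, e \in edges -> #|e| = 2%N;
  vcol : vertex -> nat;
  ecol : {set vertex} -> nat
}.

Definition adj (G : cgraph) (v v' : G) : bool := [set v; v'] \in edges G.

Definition gsize (G : cgraph) : nat := (#|G| + #|edges G|)%N.

Definition isomorphism (G H : cgraph) (f : G -> H) : Prop :=
  [/\ bijective f,
      forall v v' : G, adj v v' = adj (f v) (f v'),
      forall v : G, vcol v = vcol (f v)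
    & forall v v' : G, adj v v' -> ecol [set v; v'] = ecol [set f v; f v']].

Definition isomorphic (G H : cgraph) : Prop :=
  exists f : G -> H, isomorphism f.

(* Partial maps are given by their graphs, as subsets of V(G) x V(H): the
   first two clauses say that the relation is functional and injective. *)
Definition local_iso (G H : cgraph) (p : {set G * H}) : Prop :=
  [/\ forall (v : G) (w w' : H), (v, w) \in p -> (v, w') \in p -> w = w',
      forall (v v' : G) (w : H), (v, w) \in p -> (v', w) \in p -> v = v',
      forall (v v' : G) (w w' : H), (v, w) \in p -> (v', w') \in p ->
        adj v v' = adj w w',
      forall (v : G) (w : H), (v, w) \in p -> vcol v = vcol w
    & forall (v v' : G) (w w' : H), (v, w) \in p -> (v', w') \in p ->
        adj v v' -> ecol [set v; v'] = ecol [set w; w']].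

Section PolynomialCalculus.
Variables (F : fieldType) (N : nat).
Implicit Types (P : {mpoly F[N]} -> Prop) (s : seq {mpoly F[N]}).

Variant pc_step P s : {mpoly F[N]} -> Prop :=
| PCAxiom p : P p -> pc_step P s p
| PCBool (i : 'I_N) : pc_step P s ('X_i ^+ 2 - 'X_i)
| PCMul (i : 'I_N) f : f \in s -> pc_step P s ('X_i * f)
| PCLin (a b : F) g f : g \in s -> f \in s -> pc_step P s (a *: g + b *: f).

Definition pc_derivation P s : Prop :=
  forall i : nat, (i < size s)%N -> pc_step P (take i s) s`_i.

(* [msize p] is one more than the total degree of [p], and 0 if [p = 0]. *)
Definition pc_degree s : nat := (\max_(p <- s) (msize p).-1)%N.

Definition pc_derivable (d : nat) P (p : {mpoly F[N]}) : Prop :=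
  exists s, pc_derivation P (rcons s p) /\ (pc_degree (rcons s p) <= d)%N.

Definition pc_refutable (d : nat) P : Prop := pc_derivable d P 1.

End PolynomialCalculus.

Definition psatz_refutable (R : realType) (N : nat) (d : nat)
    (P : {mpoly R[N]} -> Prop) : Prop :=
  exists hs : seq {mpoly R[N]},
    pc_derivable d P (1 + \sum_(h <- hs) h ^+ 2).

Definition niso (G H : cgraph) : nat := #|{: G * H}|.

Definition xvar (F : fieldType) (G H : cgraph) (v : G) (w : H) :
  {mpoly F[niso G H]} := 'X_(enum_rank (v, w)).

Variant Piso (F : fieldType) (G H : cgraph) : {mpoly F[niso G H]} -> Prop :=
| PisoCol (w : H) : Piso (\sum_(v : G) xvar F v w - 1)
| PisoRow (v : G) : Piso (\sum_(w : H) xvar F v w - 1)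
| PisoLocal (v v' : G) (w w' : H) :
    ~ local_iso [set (v, w); (v', w')] ->
    Piso (xvar F v w * xvar F v' w').

(* Main.v *)
(* Take a linear system [A z = b] over F_2 with [m] unknowns and [m + 1]
   equations of at most five unknowns each, such that the sum of any few
   equations involves at least as many unknowns as equations; such [A] exist by
   counting, and some [b] makes the system unsolvable.  In the CFI-style graphs
   [cfi 0] and [cfi b] the gadget of equation [i] carries all assignments to its
   five slots, coloured by their parity, twisted by [b i] in the second graph.
   Any [z] in F_2^m shifts the common underlying graph, respecting the colours
   of the gadgets of exactly the equations that [z] satisfies; hence isomorphisms
   are solutions, and there are none.

   Evaluate polynomials at the 0/1 points given by the shifts: a polynomial of
   degree [d] becomes a combination of characters [chi S] of F_2^m with
   [S] of weight at most [5 d].  Let [sigma S] be the value of [chi S] forced by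
   combining few equations, and 0 if there is none; by expansion this is well
   defined and multiplicative on light vectors.  In characteristic other than 2
   there is a linear functional with [chi S |-> sigma S].  It annihilates
   [chi T * p] for all light [T] and all polynomials [p] derived in degree [n],
   it maps 1 to 1, and over the reals it is nonnegative on squares of low
   degree. *)

Require Import Defs.
From mathcomp Require Import all_boot all_order all_algebra.
From mathcomp Require Import reals.
From mathcomp Require Import mpoly zify ring.

Set Implicit Arguments.
Unset Strict Implicit.
Unset Printing Implicit Defensive.

Import Order.TTheory GRing.Theory Num.Theory.
Local Open Scope ring_scope.

(** * Elementary bounds on binomials, unions and sums *)

Lemma leq_bin_exp2 n k : ('C(n, k) <= 2 ^ n)%N.
Proof.
have [lt_nk|le_kn] := ltnP n k; first by rewrite bin_small.
rewrite -[2%N]/(1 + 1)%N expnDn.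
rewrite (bigD1 (Ordinal (le_kn : k < n.+1)%N)) //= !exp1n !muln1.
exact: leq_addr.
Qed.

Lemma leq_ffact_exp n k : (n ^_ k <= n ^ k)%N.
Proof.
rewrite ffact_prod -[X in (_ <= n ^ X)%N]card_ord -prod_nat_const.
by apply: leq_prod => i _; rewrite leq_subr.
Qed.

(* [k ^ k <= (2 k) ^_ k] compares factors, and [(2 k) ^_ k] is
   ['C(2 k, k) * k`!]. *)
Lemma leq_expn_fact k : (k ^ k <= 4 ^ k * k`!)%N.
Proof.
apply: (@leq_trans ((k.*2) ^_ k)).
  rewrite ffact_prod -{2}[k]card_ord -prod_nat_const.
  by apply: leq_prod => i _; have := ltn_ord i; lia.
rewrite -bin_ffact leq_mul2r (leq_trans (leq_bin_exp2 _ _)) ?orbT //.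
by rewrite -mul2n expnM.
Qed.

(** The bound [(e n / k) ^ k] on binomials, with 4 in place of [e] and without division. *)
Lemma leq_bin_expn n k : ('C(n, k) * k ^ k <= (4 * n) ^ k)%N.
Proof.
apply: (@leq_trans ('C(n, k) * (4 ^ k * k`!))).
  by rewrite leq_mul2l leq_expn_fact orbT.
by rewrite mulnCA bin_ffact expnMn leq_mul2l leq_ffact_exp orbT.
Qed.

Lemma leq_card_bigcup (I T : finType) (P : pred I) (B : I -> {set T}) :
  (#|\bigcup_(i | P i) B i| <= \sum_(i | P i) #|B i|)%N.
Proof.
elim/big_rec2: _ => [|i s A _ le_sA]; first by rewrite cards0.
by rewrite (leq_trans (leq_card_setU _ _)) // leq_add2l.
Qed.

Lemma leq_sum_draws k l (F : {set 'I_k} -> nat) c :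
  (forall A : {set 'I_k}, #|A| = l -> (F A <= c)%N) ->
  (\sum_(A : {set 'I_k} | #|A| == l) F A <= 'C(k, l) * c)%N.
Proof.
move=> leFc; apply: (@leq_trans (\sum_(A : {set 'I_k} | #|A| == l) c)).
  by apply: leq_sum => A /eqP; apply: leFc.
by rewrite sum_nat_const -cardsE card_draws card_ord.
Qed.

Lemma subset_extend_card (T : finType) (A : {set T}) k :
  (#|A| <= k <= #|T|)%N -> exists2 B : {set T}, A \subset B & #|B| = k.
Proof.
elim: k => [|k IHk] /andP[leAk lekT].
  by exists A => //; apply/eqP; rewrite -leqn0.
move: leAk; rewrite leq_eqVlt => /orP[/eqP eqA|leAk]; first by exists A.
have [|B sAB cardB] := IHk; first by rewrite -ltnS leAk ltnW.
have [x xB] : exists x, x \notin B.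
  apply/existsP; rewrite -negb_forall; apply/forallP => allB.
  have: #|T| = k.
    by rewrite -cardB -cardsT; apply: eq_card => y; rewrite !inE allB.
  by lia.
exists (x |: B); first by rewrite (subset_trans sAB) ?subsetU1.
by rewrite cardsU1 xB cardB.
Qed.

(** By induction, the partial sum up to [k] is at most [M (1 - 4 ^ -k)]. *)
Lemma sum_geometric_lt (M K : nat) (t : nat -> nat) :
  (0 < M)%N -> (forall u, (0 < u <= K)%N -> (t u * 4 ^ u <= M)%N) ->
  (\sum_(u < K.+1 | (0 < u)%N) t u < M)%N.
Proof.
move=> M_gt0 tM.
have step k : (k <= K)%N ->
    ((\sum_(u < k.+1 | (0 < u)%N) t u) * 4 ^ k + M <= M * 4 ^ k)%N.
  elim: k => [|k IHk] ltkK.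
    by rewrite big_mkcond big_ord_recl big_ord0 /= expn0 !muln1.
  have {}IHk := IHk (ltnW ltkK).
  rewrite big_mkcond big_ord_recr /= -big_mkcond /=.
  have := tM k.+1; rewrite ltkK => /(_ isT); rewrite expnS.
  move: (\sum_(_ < _ | _) _)%N (4 ^ k)%N (t k.+1) IHk => s e x; nia.
have := step K (leqnn K); have: (0 < 4 ^ K)%N by rewrite expn_gt0.
move: (\sum_(_ < _ | _) _)%N (4 ^ K)%N => s e; nia.
Qed.

(** * Existence of an expander by a union bound *)

Section Expander.
Variables (r m : nat).
Implicit Type f : {ffun 'I_r * 'I_5 -> 'I_m}.

Definition nbhd f (U : {set 'I_r}) : {set 'I_m} :=
  [set f (i, j) | i in U, j in 'I_5].

(** The slots take independent values: those of rows in [U] are confined to [N], the others are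
    free. *)
Lemma card_nbhd_sub (U : {set 'I_r}) (N : {set 'I_m}) :
  #|[set f | nbhd f U \subset N]| = (#|N| ^ (5 * #|U|) * m ^ (5 * (r - #|U|)))%N.
Proof.
pose D (x : 'I_r * 'I_5) : {set 'I_m} := if x.1 \in U then N else [set: 'I_m].
have -> : #|[set f | nbhd f U \subset N]| = #|(family D : {pred {ffun _ -> _}})|.
  rewrite -cardsE; apply: eq_card => f; rewrite !inE; apply/subsetP/familyP.
    move=> sN [i j]; rewrite /D /=; case: ifP => [iU|_]; last by rewrite inE.
    by apply: sN; apply/imset2P; exists i j.
  by move=> fD e /imset2P[i j iU _ ->]; have := fD (i, j); rewrite /D /= iU.
rewrite card_family foldrE big_map big_enum /=.
rewrite (bigID (fun x : 'I_r * 'I_5 => x.1 \in U)) /=.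
rewrite (eq_bigr (fun _ => #|N|)) => [|x xU]; last by rewrite /D xU.
rewrite [X in (_ * X)%N](eq_bigr (fun _ => m)) => [|x xU]; last first.
  by rewrite /D (negbTE xU) cardsT card_ord.
have cardX (V : {set 'I_r}) : #|[pred x : 'I_r * 'I_5 | x.1 \in V]| = (5 * #|V|)%N.
  rewrite -[5%N in RHS]card_ord mulnC -cardX -cardsE.
  by apply: eq_card => -[i j]; rewrite !inE andbT.
rewrite !prod_nat_const cardX; congr (_ * _ ^ _)%N.
rewrite (_ : r - #|U| = #|~: U|)%N; last by rewrite [RHS]cardsCs setCK card_ord.
rewrite -cardX.
by apply: eq_card => x; rewrite !inE.
Qed.

(** If [U] fails to expand, its neighbourhood lies in some [N] of size exactly [3 #|U|]. The pairs
    with [#|U| = u] spoil at most a fraction [4 ^ -u] of all [f]. In the constant, 8 comes from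
    [4 r <= 8 m], 64 from [(4 m) ^ 3], and [4 * 9] from [4 ^ u * (3 u) ^ (2 u)]. *)
Lemma expander_exists K : (r <= 2 * m)%N -> (0 < m)%N ->
  (4 * (8 * (64 * 9)) * K <= m)%N -> (K <= r)%N ->
  exists f, forall U : {set 'I_r}, (0 < #|U| <= K)%N ->
    (3 * #|U| < #|nbhd f U|)%N.
Proof.
move=> le_r2m m_gt0 leKm leKr.
pose B (U : {set 'I_r}) (N : {set 'I_m}) := [set f | nbhd f U \subset N].
pose bad := \bigcup_(u < K.+1 | (0 < u)%N)
  \bigcup_(U : {set 'I_r} | #|U| == u)
  \bigcup_(N : {set 'I_m} | #|N| == (3 * u)%N) B U N.
suff: (#|bad| < #|{ffun 'I_r * 'I_5 -> 'I_m}|)%N.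
  move=> lt_bad.
  have [f fbad] : exists f, f \notin bad.
    apply/existsP; rewrite -negb_forall; apply/forallP => allb.
    move: lt_bad; rewrite ltnNge => /negP; apply.
    by rewrite -cardsT subset_leq_card //; apply/subsetP => f _.
  exists f => U /andP[U_gt0 leUK]; rewrite ltnNge; apply: contra fbad => leN.
  have [|N sN cardN] := @subset_extend_card _ (nbhd f U) (3 * #|U|).
    rewrite leN card_ord; lia.
  apply/bigcupP; exists (Ordinal (leUK : #|U| < K.+1)%N) => //.
  apply/bigcupP; exists U => //; apply/bigcupP; exists N; first exact/eqP.
  by rewrite inE.
rewrite card_ffun card_prod !card_ord.
pose t u := ('C(r, u) * ('C(m, 3 * u) *
   ((3 * u) ^ (5 * u) * m ^ (5 * (r - u)))))%N.
apply: (@leq_ltn_trans (\sum_(u < K.+1 | (0 < u)%N) t u)).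
  apply: leq_trans (leq_card_bigcup _ _) _; apply: leq_sum => u _.
  apply: leq_trans (leq_card_bigcup _ _) _; apply: leq_sum_draws => U cardU.
  apply: leq_trans (leq_card_bigcup _ _) _; apply: leq_sum_draws => N cardN.
  by rewrite card_nbhd_sub cardU cardN.
apply: sum_geometric_lt => [|u /andP[u_gt0 leuK]]; first by rewrite expn_gt0 m_gt0.
have -> : (m ^ (r * 5) = (m ^ 5) ^ u * m ^ (5 * (r - u)))%N.
  by rewrite -expnM -expnD -mulnDr subnKC 1?mulnC // (leq_trans leuK).
(* Split [(3 u) ^ (5 u) * 4 ^ u] into [u ^ u], [(3 u) ^ (3 u)] and [(36 u) ^ u]; the first two are
   paired with the two binomials for [leq_bin_expn]. *)
have -> : (t u * 4 ^ u = ('C(r, u) * u ^ u) *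
    (('C(m, 3 * u) * (3 * u) ^ (3 * u)) * (36 * u) ^ u) * m ^ (5 * (r - u)))%N.
  rewrite /t (_ : 5 * u = 3 * u + 2 * u)%N; last by lia.
  rewrite (expnD (3 * u) (3 * u) (2 * u)).
  have : ((36 * u) ^ u * u ^ u = (3 * u) ^ (2 * u) * 4 ^ u)%N.
    by rewrite expnM -!expnMn; congr (_ ^ _)%N; lia.
  move: ((36 * u) ^ u)%N (u ^ u)%N ((3 * u) ^ (2 * u))%N => x y z.
  move: (4 ^ u)%N ((3 * u) ^ (3 * u))%N (m ^ _)%N 'C(r, u) 'C(m, _).
  move=> e1 e2 e3 e4 e5 eq_xyz.
  transitivity (e4 * e5 * e2 * e3 * (z * e1))%N; first by ring.
  by rewrite -eq_xyz; ring.
rewrite leq_mul2r; apply/orP; right.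
apply: (@leq_trans ((4 * r) ^ u * ((4 * m) ^ (3 * u) * (36 * u) ^ u))).
  by rewrite !leq_mul ?leq_bin_expn.
rewrite expnM -!expnMn leq_exp2r //.
have le1 : (4 * r <= 8 * m)%N by lia.
have le2 : (4 * (8 * (64 * 9)) * u <= m)%N.
  by apply: leq_trans leKm; rewrite leq_mul2l leuK orbT.
apply: (@leq_trans (8 * m * ((4 * m) ^ 3 * (36 * u)))).
  by rewrite leq_mul2r le1 orbT.
have -> : (8 * m * ((4 * m) ^ 3 * (36 * u)) = m ^ 4 * (4 * (8 * (64 * 9)) * u))%N.
  by rewrite !expnS !expn0; ring.
by rewrite [X in (_ <= X)%N]expnSr leq_mul2l le2 orbT.
Qed.

End Expander.

(** * Arithmetic and Hamming weight over F_2 *)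

Lemma F2_cases (x : 'F_2) : x = 0 \/ x = 1.
Proof. by case: x => [[|[|]]] // ?; [left|right]; apply/val_inj. Qed.

Lemma F2_neq0 (x : 'F_2) : x != 0 -> x = 1.
Proof. by case: (F2_cases x) => -> //; rewrite eqxx. Qed.

Lemma F2_addxx (V : lmodType 'F_2) (x : V) : x + x = 0.
Proof. by rewrite -mulr2n -scaler_nat pchar_Fp_0 // scale0r. Qed.

Lemma F2_addKx (V : lmodType 'F_2) (x y : V) : x + (x + y) = y.
Proof. by rewrite addrA F2_addxx add0r. Qed.

Lemma F2_addK (x y : 'F_2) : x + (x + y) = y.
Proof.
by case: (F2_cases x) => ->; case: (F2_cases y) => ->; apply/val_inj.
Qed.

Lemma F2_natr_neq0 n : (n%:R != 0 :> 'F_2) = odd n.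
Proof. by rewrite -(dvdn_pcharf (pchar_Fp (isT : prime 2))) dvdn2 negbK. Qed.

Section Weight.
Variable k : nat.
Implicit Types u v : 'rV['F_2]_k.

Definition wt u : nat := #|[set i | u 0 i != 0]|.

Lemma wt0 : wt 0 = 0%N.
Proof.
apply/eqP; rewrite cards_eq0 -subset0.
by apply/subsetP => i; rewrite !inE mxE eqxx.
Qed.

Lemma wtD u v : (wt (u + v) <= wt u + wt v)%N.
Proof.
apply: leq_trans (leq_card_setU _ _); apply/subset_leq_card/subsetP => i.
rewrite !inE mxE; apply: contraR; rewrite negb_or !negbK => /andP[/eqP-> /eqP->].
by rewrite addr0.
Qed.

Lemma wt_delta (i : 'I_k) : wt (delta_mx 0 i) = 1%N.
Proof.
rewrite -[RHS](cards1 i); apply: eq_card => j.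
by rewrite !inE mxE eqxx; case: (j == i).
Qed.

Lemma wt_sum_delta (I : finType) (f : I -> 'I_k) :
  (wt (\sum_j delta_mx 0 (f j)) <= #|I|)%N.
Proof.
rewrite -sum1_card; elim/big_rec2: _ => [|j x y _ le_yx]; first by rewrite wt0.
by rewrite (leq_trans (wtD _ _)) // wt_delta leq_add.
Qed.

End Weight.

(** * The linear system: expansion and unsolvability *)

Section IncidenceMatrix.
Variables (r m : nat) (f : {ffun 'I_r * 'I_5 -> 'I_m}).

(** Slots of one row carrying the same unknown cancel in pairs, so a row may have weight below
    five. *)
Definition incmx : 'M['F_2]_(r, m) :=
  \matrix_(i < r) \sum_(j < 5) delta_mx 0 (f (i, j)).

Lemma row_incmx i : row i incmx = \sum_(j < 5) delta_mx 0 (f (i, j)).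
Proof. exact: rowK. Qed.

Lemma wt_row_incmx i : (wt (row i incmx) <= 5)%N.
Proof.
by rewrite row_incmx (leq_trans (wt_sum_delta _)) // card_ord.
Qed.

(* If [c e] counts the slots of [U] falling on [e], then
   [2 [c e > 0] <= [c e odd] + c e]; sum over [e]. *)
Lemma wt_mul_incmx K :
    (forall U : {set 'I_r}, (0 < #|U| <= K)%N -> (3 * #|U| < #|nbhd f U|)%N) ->
  forall u, (wt u <= K)%N -> (wt u <= wt (u *m incmx))%N.
Proof.
move=> expf u leuK; pose U := [set i | u 0 i != 0].
have [U0|U_gt0] := posnP #|U|; first by rewrite /wt -/U U0.
have := expf U; rewrite U_gt0 leuK => /(_ isT) expU.
pose c e := (\sum_(i in U) \sum_(j < 5) (f (i, j) == e))%N.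
have uA e : (u *m incmx) 0 e = (c e)%:R.
  rewrite mxE natr_sum [RHS]big_mkcond /=; apply: eq_bigr => i _.
  rewrite inE; case: eqP => [->|/eqP /F2_neq0 ->]; first by rewrite mul0r.
  rewrite mul1r mxE summxE natr_sum; apply: eq_bigr => j _.
  by rewrite mxE eqxx /= eq_sym.
have sumc : (\sum_e c e = 5 * #|U|)%N.
  rewrite exchange_big /= (eq_bigr (fun=> 5%N)) ?sum_nat_const 1?mulnC //.
  move=> i _; rewrite exchange_big /= -[RHS]card_ord -sum1_card.
  apply: eq_bigr => j _; rewrite (bigD1 (f (i, j))) //= eqxx big1 // => e.
  by rewrite eq_sym => /negbTE ->.
have wtE : wt (u *m incmx) = (\sum_e odd (c e))%N.
  rewrite /wt -sum1_card big_mkcond /=; apply: eq_bigr => e _.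
  by rewrite inE uA F2_natr_neq0; case: (odd _).
have cardN : (#|nbhd f U| <= \sum_e (0 < c e))%N.
  rewrite -sum1_card big_mkcond /=; apply: leq_sum => e _.
  case: ifP => // /imset2P[i j iU _ ->].
  by rewrite /c (bigD1 i) //= (bigD1 j) //= eqxx.
have: (2 * \sum_e (0 < c e) <= \sum_e odd (c e) + \sum_e c e)%N.
  rewrite -big_split big_distrr /=; apply: leq_sum => e _.
  by case: (c e) => [|[|k]] //=; rewrite muln1 (leq_trans _ (leq_addl _ _)).
rewrite sumc -wtE; move: expU cardN; rewrite -[#|U|]/(wt u); lia.
Qed.

End IncidenceMatrix.

(** More rows than columns leave a nonzero [u] with [u *m A = 0]; for [b] take a unit vector at a
    coordinate where [u] is nonzero. *)
Lemma unsolvable_rhs m (A : 'M['F_2]_(m.+1, m)) :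
  exists b : 'cV['F_2]_m.+1, forall z : 'cV_m, A *m z <> b.
Proof.
have: kermx A != 0.
  rewrite -mxrank_eq0 mxrank_ker -lt0n subn_gt0.
  exact: leq_ltn_trans (rank_leq_col A) _.
case/rowV0Pn => u /sub_kermxP uA0 u0.
have [i ui] : exists i, u 0 i != 0.
  apply/existsP; apply: contraR u0; rewrite negb_exists => /forallP u0.
  by apply/eqP/rowP => i; rewrite mxE; apply/eqP; rewrite -[_ == _]negbK.
exists (delta_mx i 0) => z Az.
have: (u *m (A *m z)) 0 0 = 0 by rewrite mulmxA uA0 mul0mx mxE.
by rewrite Az -colE mxE => /eqP; apply/negP.
Qed.

(** * Signs and Fourier analysis on F_2^m *)

Section Sign.
Variable F : pzRingType.

Definition sgn2 (x : 'F_2) : F := if x == 0 then 1 else -1.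

Lemma sgn2_0 : sgn2 0 = 1. Proof. by rewrite /sgn2 eqxx. Qed.
Lemma sgn2_1 : sgn2 1 = -1. Proof. by []. Qed.

Lemma sgn2D x y : sgn2 (x + y) = sgn2 x * sgn2 y.
Proof.
case: (F2_cases x) => ->; first by rewrite add0r sgn2_0 mul1r.
case: (F2_cases y) => ->; first by rewrite addr0 sgn2_0 mulr1.
by rewrite (_ : 1 + 1 = 0) ?sgn2_0 ?sgn2_1 ?mulrNN ?mulr1 //; apply/val_inj.
Qed.

End Sign.

Section Characters.
Variables (F : fieldType) (m : nat).
Hypothesis two_neq0 : 2%:R != 0 :> F.
Local Notation E := 'rV['F_2]_m.
Implicit Types (S T z : E) (g h : E -> F).

Definition chi S z : F := sgn2 F ((S *m z^T) 0 0).

Lemma chi0 z : chi 0 z = 1.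
Proof. by rewrite /chi mul0mx mxE sgn2_0. Qed.

Lemma chiD S T z : chi (S + T) z = chi S z * chi T z.
Proof. by rewrite /chi mulmxDl mxE sgn2D. Qed.

Lemma chi_delta e z : chi (delta_mx 0 e) z = sgn2 F (z 0 e).
Proof. by rewrite /chi -rowE !mxE. Qed.

Lemma chiC S z : chi S z = chi z S.
Proof. by rewrite /chi -[z *m _]trmxK trmx_mul trmxK [in RHS]mxE. Qed.

(** Orthogonality: if coordinate [e] of [S] is nonzero, translating [z] by the unit vector at [e]
    negates the sum, so twice the sum is 0. *)
Lemma sum_chi S : \sum_z chi S z = (S == 0)%:R * 2%:R ^+ m.
Proof.
case: (eqVneq S 0) => [->|S0].
  under eq_bigr => z _ do rewrite chi0.
  by rewrite sumr_const card_mx card_Fp // mul1n mul1r natrX.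
have [e Se] : exists e, S 0 e != 0.
  apply/existsP; apply: contraR S0; rewrite negb_exists => /forallP S0.
  by apply/eqP/rowP => e; rewrite mxE; apply/eqP; rewrite -[_ == _]negbK.
rewrite mul0r; apply: (mulfI two_neq0); rewrite mulr0 mulr_natl mulr2n.
rewrite {1}(reindex_inj (addrI (delta_mx 0 e))) /= -big_split big1 // => z _.
by rewrite /= chiC chiD chi_delta (F2_neq0 Se) sgn2_1 mulN1r chiC addNr.
Qed.

(** Fourier degree at most [d]. The witnessing list may repeat characters, so sums concatenate lists
    and products take all pairs. *)
Definition lowdeg d g :=
  exists2 s : seq (F * E), all (fun k => wt k.2 <= d)%N s
    & forall z, g z = \sum_(k <- s) k.1 * chi k.2 z.

Lemma lowdeg_ext d g h : g =1 h -> lowdeg d g -> lowdeg d h.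
Proof. by move=> eq_gh [s sd gE]; exists s => // z; rewrite -eq_gh. Qed.

Lemma lowdegW d d' g : (d <= d')%N -> lowdeg d g -> lowdeg d' g.
Proof.
move=> led [s /allP sd gE]; exists s => //.
by apply/allP => k /sd kd; apply: leq_trans led.
Qed.

Lemma lowdeg_chi d S : (wt S <= d)%N -> lowdeg d (chi S).
Proof.
move=> Sd; exists [:: (1, S)] => [|z]; first by rewrite /= Sd.
by rewrite big_seq1 mul1r.
Qed.

Lemma lowdeg_const a : lowdeg 0 (fun=> a).
Proof.
by exists [:: (a, 0)] => [|z]; rewrite ?big_seq1 /= ?wt0 // chi0 mulr1.
Qed.

Lemma lowdegD d g h : lowdeg d g -> lowdeg d h -> lowdeg d (fun z => g z + h z).
Proof.
move=> [s sd gE] [t td hE]; exists (s ++ t) => [|z]; first by rewrite all_cat sd.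
by rewrite big_cat /= gE hE.
Qed.

Lemma lowdegM d d' g h :
  lowdeg d g -> lowdeg d' h -> lowdeg (d + d') (fun z => g z * h z).
Proof.
move=> [s /allP sd gE] [t /allP td hE].
exists [seq (k.1 * l.1, k.2 + l.2) | k <- s, l <- t] => [|z].
  apply/allP => _ /allpairsP[[k l] /= [/sd kd /td ld ->]] /=.
  by rewrite (leq_trans (wtD _ _)) ?leq_add.
rewrite big_allpairs_dep /= gE hE mulr_suml; apply: eq_bigr => k _.
rewrite mulr_sumr; apply: eq_bigr => l _; rewrite chiD; ring.
Qed.

Lemma lowdeg_sum (I : eqType) (s : seq I) d (g : I -> E -> F) :
  (forall i, i \in s -> lowdeg d (g i)) ->
  lowdeg d (fun z => \sum_(i <- s) g i z).
Proof.
elim: s => [|i s IHs] gd.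
  apply: (@lowdeg_ext _ (fun=> 0)) => [z|]; first by rewrite big_nil.
  by apply: lowdegW (lowdeg_const 0).
apply: (@lowdeg_ext _ (fun z => g i z + \sum_(j <- s) g j z)).
  by move=> z; rewrite big_cons.
apply: lowdegD; first by apply: gd; rewrite mem_head.
by apply: IHs => j js; apply: gd; rewrite inE js orbT.
Qed.

Lemma lowdeg_prod (I : Type) (s : seq I) (d : I -> nat) (g : I -> E -> F) :
  (forall i, lowdeg (d i) (g i)) ->
  lowdeg (\sum_(i <- s) d i) (fun z => \prod_(i <- s) g i z).
Proof.
move=> gd; elim: s => [|i s IHs].
  apply: (@lowdeg_ext _ (fun=> 1)) => [z|]; first by rewrite big_nil.
  by rewrite big_nil; apply: lowdeg_const.
rewrite big_cons.
apply: (@lowdeg_ext _ (fun z => g i z * \prod_(j <- s) g j z)).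
  by move=> z; rewrite big_cons.
exact: lowdegM.
Qed.

Lemma lowdegX d g k : lowdeg d g -> lowdeg (d * k) (fun z => g z ^+ k).
Proof.
move=> gd; elim: k => [|k IHk]; first by rewrite muln0; apply: lowdeg_const.
rewrite mulnS; apply: (@lowdeg_ext _ (fun z => g z * g z ^+ k)) => [z|].
  by rewrite exprS.
exact: lowdegM.
Qed.

(** * The linear functional attached to a partial character *)

Section PseudoExpectation.
Variables (B : nat) (sigma : E -> F).
Hypothesis sigma0 : sigma 0 = 1.
(** This includes [sigma T = 0]: adding a vector with a forced value to one without leaves it
    without. *)
Hypothesis sigmaD : forall S T, (wt S <= B)%N -> (wt T <= B)%N ->
  sigma S != 0 -> sigma (S + T) = sigma S * sigma T.

(** Divided by [2 ^ m], the inner sum is the Fourier coefficient of [g] at [S]. This is thus the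
    linear map with [chi S |-> sigma S], independent of any chosen expansion of [g]. *)
Definition pexp g : F :=
  (2%:R ^+ m)^-1 * \sum_S sigma S * \sum_z chi S z * g z.

Lemma pexp_ext g h : g =1 h -> pexp g = pexp h.
Proof.
move=> eq_gh; congr (_ * _); apply: eq_bigr => S _; congr (_ * _).
by apply: eq_bigr => z _; rewrite eq_gh.
Qed.

Lemma pexpZ a g : pexp (fun z => a * g z) = a * pexp g.
Proof.
rewrite /pexp mulrCA; congr (_ * _); rewrite mulr_sumr; apply: eq_bigr => S _.
rewrite mulrCA; congr (_ * _); rewrite mulr_sumr; apply: eq_bigr => z _.
by rewrite mulrCA.
Qed.

Lemma pexpD g h : pexp (fun z => g z + h z) = pexp g + pexp h.
Proof.
rewrite /pexp -mulrDr -big_split /=; congr (_ * _); apply: eq_bigr => S _.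
by rewrite -mulrDr -big_split; congr (_ * _); apply: eq_bigr => z _; rewrite mulrDr.
Qed.

Lemma pexp0 : pexp (fun=> 0) = 0.
Proof.
rewrite -[RHS](mul0r (pexp (fun=> 0))) -pexpZ.
by apply: pexp_ext => z; rewrite mul0r.
Qed.

Lemma pexp_sum (I : Type) (s : seq I) (g : I -> E -> F) :
  pexp (fun z => \sum_(i <- s) g i z) = \sum_(i <- s) pexp (g i).
Proof.
elim: s => [|i s IHs].
  by rewrite big_nil -[RHS]pexp0; apply: pexp_ext => z; rewrite big_nil.
by rewrite big_cons -IHs -pexpD; apply: pexp_ext => z; rewrite big_cons.
Qed.

Lemma pexp_chi S : pexp (chi S) = sigma S.
Proof.
rewrite /pexp (bigD1 S) //= [X in _ + X]big1 ?addr0 => [|T neqTS].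
  under eq_bigr => z _ do rewrite -chiD.
  by rewrite F2_addxx sum_chi eqxx mul1r mulrC mulfK // expf_neq0.
under eq_bigr => z _ do rewrite -chiD.
rewrite sum_chi; case: eqP => [TS|_]; last by rewrite mul0r mulr0.
by case/eqP: neqTS; rewrite -(F2_addKx S T) [S + T]addrC TS addr0.
Qed.

Lemma pexp_lin s (g : E -> F) T :
  (forall z, g z = \sum_(k <- s) k.1 * chi k.2 z) ->
  pexp (fun z => chi T z * g z) = \sum_(k <- s) k.1 * sigma (T + k.2).
Proof.
move=> gE; under eq_bigr => k _ do rewrite -pexp_chi -pexpZ.
rewrite -pexp_sum; apply: pexp_ext => z; rewrite gE mulr_sumr.
by apply: eq_bigr => k _; rewrite chiD mulrCA.
Qed.

Lemma wtD_le S T a b c :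
  (wt S <= a)%N -> (wt T <= b)%N -> (a + b <= c)%N -> (wt (S + T) <= c)%N.
Proof.
by move=> Sa Tb; apply: leq_trans; apply: leq_trans (wtD _ _) (leq_add _ _).
Qed.

(* Either no character of [g] is related to [T], or [T] can be replaced by a
   character of [g] related to it. *)
Lemma pexp_extend d L g : (d + d <= B)%N -> (L + d <= B)%N -> lowdeg d g ->
  (forall T, (wt T <= d)%N -> pexp (fun z => chi T z * g z) = 0) ->
  forall T, (wt T <= L)%N -> pexp (fun z => chi T z * g z) = 0.
Proof.
move=> ddB LdB [s /allP sd gE] g0 T TL; rewrite (pexp_lin _ gE).
have [/hasP[k0 k0s sk0]|/hasPn all0] :=
  boolP (has (fun k => sigma (T + k.2) != 0) s); last first.
  rewrite big_seq big1 // => k /all0; rewrite negbK => /eqP ->.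
  by rewrite mulr0.
have := g0 _ (sd _ k0s); rewrite (pexp_lin _ gE) => gk0.
rewrite (eq_big_seq (fun k => sigma (T + k0.2) * (k.1 * sigma (k0.2 + k.2)))).
  by rewrite -mulr_sumr gk0 mulr0.
move=> k ks /=; rewrite mulrCA -sigmaD //.
- by rewrite -addrA F2_addKx.
- exact: wtD_le TL (sd _ k0s) LdB.
- exact: wtD_le (sd _ k0s) (sd _ ks) ddB.
Qed.

(** Apply [sigmaD] to each character of [g]. For [A] a row of the system, the functional thus treats
    that equation as satisfied. *)
Lemma pexp_mul_chi d g A : (d <= B)%N -> (wt A <= B)%N -> sigma A != 0 ->
  lowdeg d g -> pexp (fun z => chi A z * g z) = sigma A * pexp g.
Proof.
move=> dB AB sA [s /allP sd gE]; rewrite (pexp_lin _ gE).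
rewrite (eq_big_seq (fun k => sigma A * (k.1 * sigma k.2))) => [|k ks /=].
  rewrite -mulr_sumr; congr (_ * _).
  under eq_bigr => k _ do rewrite -pexp_chi -pexpZ.
  by rewrite -pexp_sum; apply: pexp_ext => z; rewrite gE.
by rewrite sigmaD ?(leq_trans (sd _ ks)) // mulrCA.
Qed.

Lemma sigma_sqr S : (wt S <= B)%N -> sigma S != 0 -> sigma S * sigma S = 1.
Proof. by move=> SB sS; rewrite -sigmaD // F2_addxx sigma0. Qed.

End PseudoExpectation.
End Characters.

(** * Nonnegativity on squares *)

Section Positivity.
Variables (R : realFieldType) (m B : nat) (sigma : 'rV['F_2]_m -> R).
Hypothesis sigma0 : sigma 0 = 1.
Hypothesis sigmaD : forall S T, (wt S <= B)%N -> (wt T <= B)%N ->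
  sigma S != 0 -> sigma (S + T) = sigma S * sigma T.

(* [sigma (S + T) != 0] is an equivalence relation on the vectors of weight at
   most [d], and on each class the Gram matrix has rank one; the sum of squares
   runs over all [T], weighted by the inverse of the size of their class. *)
Lemma pexp_sqr_ge0 d g : (d + d <= B)%N -> lowdeg d g ->
  0 <= pexp sigma (fun z => g z * g z).
Proof.
move=> ddB [s /allP sd gE].
have two0 : 2%:R != 0 :> R by rewrite pnatr_eq0.
pose N (T : 'rV_m) : R := #|[set T' | (wt T' <= d)%N & sigma (T + T') != 0]|%:R.
have DB (S T : 'rV['F_2]_m) : (wt S <= d)%N -> (wt T <= d)%N -> (wt (S + T) <= B)%N.
  by move=> Sd Td; apply: wtD_le Sd Td ddB.
have gram S S' : (wt S <= d)%N -> (wt S' <= d)%N ->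
    \sum_(T | (wt T <= d)%N) (N T)^-1 * (sigma (S + T) * sigma (S' + T))
      = sigma (S + S').
  move=> Sd S'd.
  rewrite (bigID (fun T => sigma (S + T) != 0)) /= [X in _ + X]big1 => [|T]; last first.
    by rewrite negbK => /andP[_ /eqP->]; rewrite mul0r mulr0.
  rewrite addr0 (eq_bigr (fun=> (N S)^-1 * sigma (S + S'))) => [|T /andP[Td sST]].
    rewrite sumr_const -cardsE -mulrnAl -[X in X * _]mulr_natl mulfV ?mul1r //.
    rewrite pnatr_eq0 -lt0n; apply/card_gt0P; exists S.
    by rewrite inE unfold_in Sd F2_addxx sigma0 oner_eq0.
  have -> : N T = N S.
    congr _%:R; apply: eq_card => T'; rewrite !inE; apply: andb_id2l => T'd.
    have -> : T + T' = (S + T) + (S + T') by rewrite addrACA F2_addxx add0r.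
    by rewrite sigmaD ?DB // mulf_eq0 negb_or sST.
  have -> : S' + T = (S + T) + (S + S') by rewrite addrACA F2_addxx add0r addrC.
  rewrite [sigma (_ + (S + S'))]sigmaD ?DB // [_ (S + T) * (_ * _)]mulrA.
  by rewrite (sigma_sqr sigma0 sigmaD) ?DB // mul1r.
suff -> : pexp sigma (fun z => g z * g z) = \sum_(T | (wt T <= d)%N)
    (N T)^-1 * (\sum_(k <- s) k.1 * sigma (k.2 + T)) ^+ 2.
  by apply: sumr_ge0 => T _; rewrite mulr_ge0 ?sqr_ge0 // invr_ge0 ler0n.
transitivity (\sum_(k <- s) \sum_(l <- s) k.1 * (l.1 * sigma (k.2 + l.2))).
  rewrite (@pexp_ext _ _ _ _ (fun z => \sum_(k <- s) k.1 * (chi R k.2 z * g z))).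
    rewrite pexp_sum; apply: eq_bigr => k _; rewrite pexpZ (pexp_lin two0 _ _ gE).
    by rewrite mulr_sumr.
  move=> z; rewrite {1}gE mulr_suml; apply: eq_bigr => k _; by rewrite mulrA.
rewrite (eq_bigr (fun T => \sum_(k <- s) \sum_(l <- s)
   k.1 * (l.1 * ((N T)^-1 * (sigma (k.2 + T) * sigma (l.2 + T)))))); last first.
  move=> T _; rewrite expr2 mulr_suml mulr_sumr; apply: eq_bigr => k _.
  rewrite !mulr_sumr; apply: eq_bigr => l _; ring.
rewrite [RHS]exchange_big /=; apply: eq_big_seq => k ks.
rewrite [RHS]exchange_big /=; apply: eq_big_seq => l ls.
by rewrite -!mulr_sumr gram ?sd.
Qed.

End Positivity.

(** * The partial character forced by an expanding system *)

Section PartialCharacter.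
Variables (F : fieldType) (r m : nat).
Variables (A : 'M['F_2]_(r, m)) (b : 'cV['F_2]_r) (K B : nat).
Hypothesis expA : forall u : 'rV_r, (wt u <= K + K)%N -> (wt u <= wt (u *m A))%N.
Hypothesis leBK : (B + B <= K)%N.

Definition pchi (S : 'rV['F_2]_m) : F :=
  if [pick u : 'rV['F_2]_r | (wt u <= K)%N && (u *m A == S)] is Some u
  then sgn2 F ((u *m b) 0 0) else 0.

Lemma wt_eq0 k (u : 'rV['F_2]_k) : wt u = 0%N -> u = 0.
Proof.
move=> /eqP; rewrite cards_eq0 => /eqP u0; apply/rowP => i; rewrite mxE.
by apply/eqP; have := in_set0 i; rewrite -u0 inE => /negbFE.
Qed.

(** Makes the choice in [pchi] immaterial: [u + v] has weight at most [2 K] and is sent to 0, so by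
    expansion it is 0. *)
Lemma mulmx_light_inj (u v : 'rV['F_2]_r) :
  (wt u <= K)%N -> (wt v <= K)%N -> u *m A = v *m A -> u = v.
Proof.
move=> uK vK uvA.
have uv0 : u + v = 0.
  apply: wt_eq0; apply/eqP; rewrite -leqn0 (leq_trans (expA _)) //.
    exact: wtD_le uK vK _.
  by rewrite mulmxDl uvA F2_addxx wt0.
by rewrite -[u](F2_addKx v) [v + u]addrC uv0 addr0.
Qed.

Lemma pchi_mulmx u : (wt u <= K)%N -> pchi (u *m A) = sgn2 F ((u *m b) 0 0).
Proof.
move=> uK; rewrite /pchi; case: pickP => [v /andP[vK /eqP vA]|/(_ u)].
  by rewrite (mulmx_light_inj vK uK vA).
by rewrite uK eqxx.
Qed.

Lemma pchi_neq0 S : pchi S != 0 -> exists2 u, (wt u <= K)%N & S = u *m A.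
Proof.
rewrite /pchi; case: pickP => [u /andP[uK /eqP <-] _|_]; first by exists u.
by rewrite eqxx.
Qed.

Lemma pchi0 : pchi 0 = 1.
Proof. by rewrite -(mul0mx _ A) pchi_mulmx ?wt0 // mul0mx mxE sgn2_0. Qed.

Lemma sgn2_neq0 x : sgn2 F x != 0.
Proof. by rewrite /sgn2; case: (x == 0); rewrite ?oppr_eq0 oner_eq0. Qed.

(** Combinations producing [S] and [T] add up to one producing [S + T]. If [T] has no light
    combination, neither has [S + T], since adding the one of [S] back would give one for [T]. *)
Lemma pchiD S T : (wt S <= B)%N -> (wt T <= B)%N ->
  pchi S != 0 -> pchi (S + T) = pchi S * pchi T.
Proof.
move=> SB TB /pchi_neq0[u uK SE].
(* The sum of two light combinations has weight at most [2 K], within reach of expansion; a result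
   of weight at most [2 B] then brings it back to at most [K]. *)
have light v w : (wt v <= K)%N -> (wt w <= K)%N ->
    (wt ((v + w) *m A) <= B + B)%N -> (wt (v + w) <= K)%N.
  move=> vK wK vwB; apply: leq_trans leBK; apply: leq_trans vwB; apply: expA.
  exact: wtD_le vK wK _.
have [T0|/pchi_neq0[v vK TE]] := eqVneq (pchi T) 0.
  rewrite T0 mulr0; apply/eqP; apply/idPn => /pchi_neq0[v vK STE].
  have TE : T = (u + v) *m A by rewrite mulmxDl -STE -SE F2_addKx.
  have := sgn2_neq0 (((u + v) *m b) 0 0).
  rewrite -pchi_mulmx -?TE ?T0 ?eqxx // light // -TE.
  by rewrite (leq_trans TB) ?leq_addr.
have STE : S + T = (u + v) *m A by rewrite mulmxDl SE TE.
rewrite STE pchi_mulmx ?light // -?STE; last exact: wtD_le SB TB _.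
by rewrite SE TE !pchi_mulmx // mulmxDl mxE sgn2D.
Qed.

Lemma pchi_row i : (0 < K)%N -> pchi (row i A) = sgn2 F (b i 0).
Proof. by move=> K0; rewrite rowE pchi_mulmx ?wt_delta // -rowE mxE. Qed.

End PartialCharacter.

(** * The CFI graphs, their shifts and their isomorphisms *)

Section CFIGraph.
Variables (r m : nat) (f : {ffun 'I_r * 'I_5 -> 'I_m}).

(** [inl (e, c)] stands for the unknown [e] having value [c], and [inr (i, a)] for the assignment
    [a] to the slots of equation [i]; the latter is joined to the values it picks. *)
Definition vert : finType := ('I_m * 'F_2 + 'I_r * 'rV['F_2]_5)%type.

Definition gadget_edge (x : 'I_r * 'rV['F_2]_5 * 'I_5) : {set vert} :=
  [set (inr x.1 : vert); (inl (f (x.1.1, x.2), x.1.2 0 x.2) : vert)].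

Definition gadget_edges : {set {set vert}} := [set gadget_edge x | x in predT].

Lemma gadget_edges_card2 (e : {set vert}) : e \in gadget_edges -> #|e| = 2%N.
Proof. by case/imsetP=> x _ ->; rewrite cards2. Qed.

Definition vert_class (c : 'cV['F_2]_r) (v : vert) : 'I_m + 'I_r * 'F_2 :=
  match v with
  | inl (e, _) => inl e
  | inr (i, a) => inr (i, \sum_j a 0 j + c i 0)
  end.

Definition gadget_vcol (c : 'cV['F_2]_r) (v : vert) : nat :=
  pickle (vert_class c v).

(* The parity of the [i]-th constraint is recorded in the vertex colours only,
   so that the two graphs share their vertices and edges. *)
Definition cfi (c : 'cV['F_2]_r) : cgraph :=
  @CGraph vert gadget_edges gadget_edges_card2 (gadget_vcol c) (fun=> 0%N).

Lemma card_cfi c : #|cfi c| = (m * 2 + r * 32)%N.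
Proof. by rewrite card_sum !card_prod !card_ord card_mx card_ord. Qed.

Lemma gsize_cfi c : (gsize (cfi c) <= m * 2 + r * 32 + r * 32 * 5)%N.
Proof.
rewrite /gsize card_cfi leq_add2l /=; apply: leq_trans (leq_imset_card _ _) _.
by rewrite !card_prod !card_ord card_mx card_ord.
Qed.

Definition slots (z : 'rV['F_2]_m) (i : 'I_r) : 'rV['F_2]_5 :=
  \row_j z 0 (f (i, j)).

Definition shift (z : 'rV['F_2]_m) (v : vert) : vert :=
  match v with
  | inl (e, c) => inl (e, z 0 e + c)
  | inr (i, a) => inr (i, slots z i + a)
  end.

Lemma shiftK z : involutive (shift z).
Proof.
by case=> [[e c]|[i a]] /=; rewrite ?F2_addK ?F2_addKx.
Qed.

(** A shift sends the edge at slot [j] of [a] to the edge at slot [j] of [slots z i + a]; being an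
    involution, it also reflects adjacency. *)
Lemma adj_shift c c' z (v w : vert) :
  @adj (cfi c) v w = @adj (cfi c') (shift z v) (shift z w).
Proof.
have edge_shift (e : {set vert}) : e \in gadget_edges -> shift z @: e \in gadget_edges.
  case/imsetP=> -[[i a] j] _ ->; apply/imsetP; exists (i, slots z i + a, j) => //.
  by rewrite /gadget_edge imsetU1 imset_set1 /= !mxE.
have adj_imp v' w' : @adj (cfi c) v' w' -> @adj (cfi c') (shift z v') (shift z w').
  by move/edge_shift; rewrite imsetU1 imset_set1.
apply/idP/idP; first exact: adj_imp.
by move/adj_imp; rewrite !shiftK.
Qed.

Lemma slots_sum z i : \sum_j (slots z i) 0 j = (row i (incmx f) *m z^T) 0 0.
Proof.
rewrite row_incmx mulmx_suml summxE; apply: eq_bigr => j _.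
by rewrite -rowE !mxE.
Qed.

(** Shifts respect everything but vertex colours, so colours are the only way a pair taken from a
    shift can fail. *)
Lemma shift_local_iso b z (v v' w w' : vert) : shift z v = w -> shift z v' = w' ->
  gadget_vcol 0 v = gadget_vcol b w -> gadget_vcol 0 v' = gadget_vcol b w' ->
  @local_iso (cfi 0) (cfi b) [set (v, w); (v', w')].
Proof.
move=> vw vw' colv colv'.
have mem (x y : vert) : (x, y) \in [set (v, w); (v', w')] ->
    y = shift z x /\ gadget_vcol 0 x = gadget_vcol b y.
  by rewrite !inE => /orP[] /eqP[-> ->].
split.
- by move=> x y y' /mem[-> _] /mem[-> _].
- by move=> x x' y /mem[-> _] /mem[/(inv_inj (shiftK z)) -> _].
- by move=> x x' y y' /mem[-> _] /mem[-> _]; apply: adj_shift.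
- by move=> x y /mem[].
- by [].
Qed.

(** Colours make [h] fix every unknown and every gadget. Let [z] be the values to which [h] sends 0;
    the zero assignment of gadget [i] goes to some [a] of parity [b i 0], and adjacency forces [a]
    to be [slots] of [z]. *)
Lemma isomorphic_solvable b : isomorphic (cfi 0) (cfi b) ->
  exists z : 'cV['F_2]_m, incmx f *m z = b.
Proof.
case=> h [/bij_inj h_inj h_adj h_col _].
have hl (e : 'I_m) (c : 'F_2) : exists c', h (inl (e, c)) = inl (e, c').
  have /(pcan_inj pickleK) := h_col (inl (e, c)).
  by case: (h _) => [[e' c']|[i a]] // [->]; exists c'.
have hr (i : 'I_r) : exists2 a, h (inr (i, 0)) = inr (i, a) & \sum_j a 0 j = b i 0.
  have /(pcan_inj pickleK) := h_col (inr (i, 0)).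
  case: (h _) => [[e' c']|[i' a]] // col_eq.
  have /= ii' := congr1 (fun x => if x is inr y then y.1 else i) col_eq.
  have /= := congr1 (fun x => if x is inr y then y.2 else 0) col_eq.
  rewrite -{}ii' in col_eq *.
  rewrite mxE addr0 big1 => [|j _]; last by rewrite mxE.
  move=> ab; exists a => //.
  by rewrite -[LHS](F2_addK (b i 0)) [b i 0 + \sum_j _]addrC -ab addr0.
pose z : 'rV['F_2]_m := \row_e (if h (inl (e, 0)) is inl (_, c) then c else 0).
have h0 e : h (inl (e, 0)) = inl (e, z 0 e).
  by rewrite mxE; case: (hl e 0) => c ->.
have h1 e c : c != z 0 e -> h (inl (e, 1)) = inl (e, c).
  move=> cz; case: (hl e 1) => c' h1; rewrite h1; congr (inl (_, _)).
  have: c' != z 0 e.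
    apply/eqP => c'z; have := h_inj (inl (e, 0)) (inl (e, 1)).
    by rewrite h0 h1 c'z => /(_ erefl).
  by move: cz; case: (F2_cases c) => ->; case: (F2_cases c') => ->;
    case: (F2_cases (z 0 e)) => ->.
exists z^T; apply/colP => i; have [a ha <-] := hr i.
have -> : (incmx f *m z^T) i 0 = (row i (incmx f) *m z^T) 0 0.
  by rewrite -row_mul [RHS]mxE.
rewrite -slots_sum; apply: eq_bigr => j _; rewrite mxE.
(* If [a] disagreed with [z] at slot [j], its neighbour there would be the image of the value 1, to
   which the zero assignment is not adjacent. *)
apply/esym/eqP; apply/idPn => az.
have: @adj (cfi b) (inr (i, a)) (inl (f (i, j), a 0 j)).
  by apply/imsetP; exists (i, a, j).
rewrite -ha -(h1 _ _ az) -h_adj => /imsetP[[[i' a'] j'] _ eqE].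
have: (inr (i, 0) : vert) \in gadget_edge (i', a', j') by rewrite -eqE !inE eqxx.
have: (inl (f (i, j), 1) : vert) \in gadget_edge (i', a', j').
  by rewrite -eqE !inE eqxx orbT.
rewrite !inE /= orbF => /eqP[_ a'1] /eqP[_ a'0].
by move: a'1; rewrite -a'0 mxE.
Qed.

End CFIGraph.

(** * Leading monomials and degrees of sums of squares *)

Lemma seq_argmax d (T : eqType) (O : orderType d) (key : T -> O)
    (s : seq T) x :
  x \in s -> exists2 y, y \in s & forall g, g \in s -> (key g <= key y)%O.
Proof.
elim: s x => // a [|a' s] IHs x _.
  by exists a; rewrite ?mem_head // => g; rewrite inE => /eqP ->.
have [y ys ymax] := IHs a' (mem_head _ _).
have [lt_ya|le_ay] := ltP (key y) (key a).
  exists a; first exact: mem_head.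
  move=> g; rewrite inE => /orP[/eqP-> //|/ymax le_gy].
  exact: le_trans le_gy (ltW lt_ya).
exists y; first by rewrite inE ys orbT.
by move=> g; rewrite inE => /orP[/eqP-> //|/ymax].
Qed.

(* The coefficient of the square of the greatest leading monomial of the [h]'s
   is a nonzero sum of squares, so it does not cancel. *)
Lemma sum_sqr_degree (R : realDomainType) N (hs : seq {mpoly R[N]}) h :
  h \in hs ->
  ((msize h).-1 + (msize h).-1 <= (msize (1 + \sum_(g <- hs) g ^+ 2)%R).-1)%N.
Proof.
move=> h_hs; have [h0 h0_hs maxh0] := seq_argmax (@mlead N R) h_hs.
have degE (g : {mpoly R[N]}) : (msize g).-1 = mdeg (mlead g).
  case: (eqVneq g 0) => [->|/mlead_deg <- //].
  by rewrite msize0 mlead0 mdeg0.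
rewrite (degE h); set p := 1 + _.
have leh : (mdeg (mlead h) <= mdeg (mlead h0))%N by apply/lemc_mdeg/maxh0.
apply: (leq_trans (leq_add leh leh)); rewrite -mdegD.
have [->|M_neq0] := eqVneq (mlead h0) 0%MM; first by rewrite mdegD mdeg0.
have h0_neq0 : h0 != 0 by apply: contraNneq M_neq0 => ->; rewrite mlead0.
suff : (mlead h0 + mlead h0)%MM \in msupp p by move/msize_mdeg_lt; lia.
rewrite mcoeff_msupp mcoeffD mcoeff1 raddf_sum /=.
have -> : (mlead h0 + mlead h0 == 0)%MM = false.
  by rewrite -mdeg_eq0 mdegD addn_eq0 mdeg_eq0 (negbTE M_neq0).
rewrite add0r (eq_big_seq (fun g : {mpoly R[N]} => g@_(mlead h0) ^+ 2)); last first.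
  by move=> g /maxh0 le_g; rewrite expr2 mleadcMW.
rewrite psumr_neq0; last by move=> g _; apply: sqr_ge0.
by apply/hasP; exists h0; rewrite // lt_def sqr_ge0 sqrf_eq0 mleadc_eq0 h0_neq0.
Qed.

Lemma leq_pc_degree (F : fieldType) N (s : seq {mpoly F[N]}) p :
  p \in s -> ((msize p).-1 <= pc_degree s)%N.
Proof. by move=> ps; apply: leq_bigmax_seq ps _. Qed.

(** * Evaluation at shifts and soundness of the derivation rules *)

Section Evaluation.
Variables (F : fieldType) (r m : nat) (f : {ffun 'I_r * 'I_5 -> 'I_m}).
Variable b : 'cV['F_2]_r.
Hypothesis two_neq0 : 2%:R != 0 :> F.
Local Notation G := (cfi f 0).
Local Notation H := (cfi f b).

Definition shift_ind (v w : vert r m) (z : 'rV['F_2]_m) : F :=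
  (shift f z v == w)%:R.

Definition shift_point (z : 'rV['F_2]_m) (k : 'I_(niso G H)) : F :=
  shift_ind (enum_val k).1 (enum_val k).2 z.

Lemma meval_xvar z (v : G) (w : H) :
  (xvar F v w).@[shift_point z] = shift_ind v w z.
Proof. by rewrite mevalXU /shift_point enum_rankK. Qed.

Lemma F2_eq_sgn2 (x y : 'F_2) : (x == y)%:R = 2%:R^-1 * (1 + sgn2 F y * sgn2 F x).
Proof.
case: (F2_cases x) => ->; case: (F2_cases y) => ->;
  rewrite ?eqxx ?sgn2_0 ?sgn2_1 ?mulrNN ?mulr1 ?mul1r /= ?subrr ?mulr0 //;
  by rewrite -[1 + 1]/2%:R mulVf.
Qed.

Lemma lowdeg_coord_eq e (c c' : 'F_2) :
  lowdeg 1 (fun z : 'rV['F_2]_m => (z 0 e + c == c')%:R : F).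
Proof.
apply: (@lowdeg_ext _ _ _ (fun z =>
    2%:R^-1 * (1 + sgn2 F (c + c') * chi F (delta_mx 0 e) z))).
  move=> z; rewrite chi_delta -F2_eq_sgn2 -(inj_eq (addrI c)).
  by rewrite F2_addK addrC.
apply: (@lowdegM _ _ 0 1); first exact: lowdeg_const.
apply: lowdegD; first exact: lowdegW (lowdeg_const _ _).
apply: (@lowdegM _ _ 0 1); first exact: lowdeg_const.
by apply: lowdeg_chi; rewrite wt_delta.
Qed.

Lemma row_eq_prod k (u v : 'rV['F_2]_k) :
  (u == v)%:R = \prod_(j <- enum 'I_k) (u 0 j == v 0 j)%:R :> F.
Proof.
rewrite big_enum /=; case: (eqVneq u v) => [->|neq_uv].
  by rewrite big1 // => j _; rewrite eqxx.
have [j uvj] : exists j, u 0 j != v 0 j.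
  apply/existsP; apply: contraR neq_uv; rewrite negb_exists => /forallP uv.
  by apply/eqP/rowP => j; apply/eqP; rewrite -[_ == _]negbK.
by rewrite (bigD1 j) //= (negbTE uvj) mul0r.
Qed.

(** An assignment vertex tests five coordinates of [z], each test having Fourier degree 1; a value
    vertex tests one. *)
Lemma lowdeg_shift_ind v w : lowdeg 5 (shift_ind v w).
Proof.
have low0 : lowdeg 5 (fun _ : 'rV['F_2]_m => 0 : F).
  exact: lowdegW (lowdeg_const _ _).
case: v w => [[e c]|[i a]] [[e' c']|[i' a']]; try exact: (lowdeg_ext _ low0).
  apply: (@lowdeg_ext _ _ _ (fun z => (e == e')%:R * (z 0 e + c == c')%:R)).
    by move=> z; rewrite -natrM mulnb.
  apply: (@lowdegW _ _ (0 + 1)) => //.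
  by apply: lowdegM; [apply: lowdeg_const|apply: lowdeg_coord_eq].
apply: (@lowdeg_ext _ _ _ (fun z => (i == i')%:R *
    \prod_(j <- enum 'I_5) (z 0 (f (i, j)) + a 0 j == a' 0 j)%:R)).
  move=> z; rewrite /shift_ind /= -[inr _ == inr _]/((_ == _) && (_ == _)).
  rewrite -mulnb natrM row_eq_prod; congr (_ * _); apply: eq_bigr => j _.
  by rewrite !mxE.
apply: (@lowdegW _ _ (0 + \sum_(j <- enum 'I_5) 1)).
  by rewrite big_enum /= sum1_card card_ord.
apply: lowdegM; first exact: lowdeg_const.
by apply: lowdeg_prod => j; apply: lowdeg_coord_eq.
Qed.

Lemma lowdeg_meval d (p : {mpoly F[niso G H]}) : ((msize p).-1 <= d)%N ->
  lowdeg (5 * d) (fun z => p.@[shift_point z]).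
Proof.
move=> pd; apply: (@lowdeg_ext _ _ _ (fun z => \sum_(k <- msupp p)
    p@_k * \prod_(i <- enum 'I_(niso G H)) shift_point z i ^+ k i)).
  by move=> z; rewrite mevalE; under eq_bigr => k _ do rewrite big_enum /=.
apply: lowdeg_sum => k kp.
apply: (@lowdegW _ _ (0 + \sum_(i <- enum 'I_(niso G H)) (5 * k i)%N)).
  rewrite add0n big_enum /= -big_distrr -mdegE leq_mul2l /=.
  by rewrite (leq_trans _ pd) // -ltnS (leq_trans (msize_mdeg_lt kp)) // leqSpred.
apply: lowdegM; first exact: lowdeg_const.
apply: (@lowdeg_prod _ _ _ _ (fun i => 5 * k i)%N
   (fun i z => shift_point z i ^+ k i)) => i.
exact/lowdegX/lowdeg_shift_ind.
Qed.

Variables (K n : nat).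
Hypothesis n_gt0 : (0 < n)%N.
Hypothesis expf : forall u : 'rV_r,
  (wt u <= K + K)%N -> (wt u <= wt (u *m incmx f))%N.
(** Large enough for [null_mulX], which needs [(5 n + 5) + 5 n], and for [Piso_null], which needs
    [5 n + 5 + 5]. *)
Let B := (10 * n + 10)%N.
Hypothesis leBK : (B + B <= K)%N.
Let sigma := pchi F (incmx f) b K.

Let sigmaD S T : (wt S <= B)%N -> (wt T <= B)%N ->
  sigma S != 0 -> sigma (S + T) = sigma S * sigma T.
Proof. exact: pchiD. Qed.

Let sigma0 : sigma 0 = 1.
Proof. exact: pchi0. Qed.

(** Shifts fix the colours of value vertices, so there the indicator is 0. For an assignment vertex
    of gadget [i], the indicator is supported on [z] violating equation [i], where the character of
    row [i] is [- sgn2 F (b i 0)]; by [pexp_mul_chi] it also acts as [sgn2 F (b i 0)]. Hence the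
    value equals its own negative. *)
Lemma pexp_violated d h (v w : vert r m) : (d + 5 <= B)%N -> lowdeg d h ->
  gadget_vcol 0 v != gadget_vcol b w ->
  pexp sigma (fun z => h z * shift_ind v w z) = 0.
Proof.
move=> dB hd col_neq.
have K_gt0 : (0 < K)%N by apply: leq_trans leBK; rewrite /B; lia.
have hind : lowdeg (d + 5) (fun z => h z * shift_ind v w z).
  by apply: lowdegM => //; apply: lowdeg_shift_ind.
case: v col_neq hind => [[e c]|[i a]] col_neq hind.
  rewrite -[RHS](pexp0 sigma); apply: pexp_ext => z.
  rewrite /shift_ind; case: eqP => [vw|_]; last by rewrite mulr0.
  by case/eqP: col_neq; rewrite -vw.
have rowE : sigma (row i (incmx f)) = sgn2 F (b i 0).
  exact: pchi_row.
have := pexp_mul_chi two_neq0 sigmaD dB _ _ hind (A := row i (incmx f)).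
rewrite -/sigma rowE sgn2_neq0 => /(_ _ isT) mul_chi.
have {}mul_chi := mul_chi (leq_trans (wt_row_incmx _ _) _).
have chi_neg : pexp sigma (fun z => chi F (row i (incmx f)) z *
    (h z * shift_ind (inr (i, a)) w z))
    = - (sgn2 F (b i 0)) * pexp sigma (fun z => h z * shift_ind (inr (i, a)) w z).
  rewrite -pexpZ; apply: pexp_ext => z.
  rewrite /shift_ind; case: eqP => [vw|_]; last by rewrite !mulr0.
  congr (_ * _); rewrite /chi -slots_sum.
  have neq : \sum_j (slots f z i) 0 j != b i 0.
    apply: contra col_neq => /eqP zb; rewrite -vw; apply/eqP.
    congr (pickle (inr (_, _))); rewrite mxE addr0 -zb [RHS]addrC -big_split /=.
    by apply: eq_bigr => j _; rewrite !mxE F2_addK.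
  move: (\sum_j _) neq => x.
  by case: (F2_cases (b i 0)) => ->; case: (F2_cases x) => ->;
    rewrite ?eqxx // ?sgn2_0 ?sgn2_1 ?opprK.
rewrite mul_chi in chi_neg; last by rewrite /B; lia.
move: (pexp _ _) chi_neg => x /eqP; rewrite mulNr -addr_eq0 -mulr2n -mulr_natl.
by rewrite !mulf_eq0 (negbTE two_neq0) (negbTE (sgn2_neq0 _ _)) => /eqP.
Qed.

(** Testing against light characters, not only the trivial one, makes this an invariant of
    multiplication. The bound [5 n] is the Fourier degree of a polynomial of degree [n], as
    [pexp_extend] requires. *)
Definition null (p : {mpoly F[niso G H]}) : Prop :=
  forall T, (wt T <= 5 * n)%N ->
  pexp sigma (fun z => chi F T z * p.@[shift_point z]) = 0.

Lemma null_vanishing p : (forall z, p.@[shift_point z] = 0) -> null p.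
Proof.
move=> p0 T _; rewrite -[RHS](pexp0 sigma).
by apply: pexp_ext => z; rewrite p0 mulr0.
Qed.

(** Row and column axioms vanish at every shift because shifts are bijections. A local axiom either
    contains a colour violation or, by [shift_local_iso], vanishes at every shift. *)
Lemma Piso_null p : Piso p -> null p.
Proof.
case=> [w|v|v v' w w' nloc].
- apply: null_vanishing => z; rewrite mevalB meval1 raddf_sum /=.
  rewrite (bigD1 (shift f z w : G)) //= meval_xvar /shift_ind shiftK eqxx.
  rewrite big1 ?addr0 ?subrr // => v neq; rewrite meval_xvar /shift_ind.
  by have [vw|//] := eqVneq (shift f z v) w; rewrite -vw shiftK eqxx in neq.
- apply: null_vanishing => z; rewrite mevalB meval1 raddf_sum /=.
  rewrite (bigD1 (shift f z v : H)) //= meval_xvar /shift_ind eqxx.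
  rewrite big1 ?addr0 ?subrr // => w neq; rewrite meval_xvar /shift_ind.
  by have [vw|//] := eqVneq (shift f z v) w; rewrite -vw eqxx in neq.
move=> T Tn.
have low_mul x y : lowdeg (5 * n + 5) (fun z => chi F T z * shift_ind x y z).
  by apply: lowdegM; [apply: lowdeg_chi|apply: lowdeg_shift_ind].
have leB : (5 * n + 5 + 5 <= B)%N by rewrite /B; lia.
have [col|col] := eqVneq (gadget_vcol 0 v) (gadget_vcol b w); last first.
  rewrite -(pexp_violated leB (low_mul v' w') col); apply: pexp_ext => z.
  by rewrite mevalM !meval_xvar; ring.
have [col'|col'] := eqVneq (gadget_vcol 0 v') (gadget_vcol b w'); last first.
  rewrite -(pexp_violated leB (low_mul v w) col'); apply: pexp_ext => z.
  by rewrite mevalM !meval_xvar; ring.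
move: T Tn {low_mul}; apply: null_vanishing => z.
rewrite mevalM !meval_xvar /shift_ind.
case: eqP => [vw|]; last by rewrite mul0r.
case: eqP => [vw'|]; last by rewrite mulr0.
by case: nloc; apply: shift_local_iso vw vw' col col'.
Qed.

(** The variable expands into characters of weight at most 5, which raise the weight of a test from
    [5 n] to [5 n + 5]; [pexp_extend] covers these. *)
Lemma null_mulX i p : ((msize p).-1 <= n)%N -> null p -> null ('X_i * p).
Proof.
move=> pn p0 T Tn.
have [s /allP sd indE] := lowdeg_shift_ind (enum_val i).1 (enum_val i).2.
rewrite (@pexp_ext _ _ _ _ (fun z => \sum_(k <- s)
    k.1 * (chi F (T + k.2) z * p.@[shift_point z]))).
  rewrite pexp_sum big_seq big1 // => k ks; rewrite pexpZ.
  rewrite (@pexp_extend _ _ two_neq0 B sigma sigmaD (5 * n) (5 * n + 5)) ?mulr0 //.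
  - by rewrite /B; lia.
  - by rewrite /B; lia.
  - exact: lowdeg_meval.
  - exact: wtD_le Tn (sd _ ks) _.
move=> z; rewrite mevalM mevalXU /shift_point indE mulr_suml mulr_sumr.
by apply: eq_bigr => k _; rewrite chiD; ring.
Qed.

Lemma null_lin a c p q : null p -> null q -> null (a *: p + c *: q).
Proof.
move=> p0 q0 T Tn.
rewrite (@pexp_ext _ _ _ _ (fun z => a * (chi F T z * p.@[shift_point z]) +
    c * (chi F T z * q.@[shift_point z]))); last first.
  by move=> z; rewrite mevalD !mevalZ; ring.
by rewrite pexpD !pexpZ p0 // q0 // !mulr0 addr0.
Qed.

Lemma derivation_null s : pc_derivation (@Piso F G H) s ->
  (pc_degree s <= n)%N -> forall p, p \in s -> null p.
Proof.
move=> der deg.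
have degp p : p \in s -> ((msize p).-1 <= n)%N.
  by move=> ps; apply: leq_trans deg; apply: leq_pc_degree.
suff nulli i : (i < size s)%N -> null s`_i.
  by move=> p /(nthP 0)[i ltis <-]; apply: nulli.
elim/ltn_ind: i => i IHi ltis.
have prev p : p \in take i s -> p \in s /\ null p.
  move=> pt; split; first exact: mem_take pt.
  have [j] := nthP 0 pt; rewrite size_take ltis => ltji <-.
  by rewrite nth_take //; apply: IHi => //; apply: ltn_trans ltis.
case: (der _ ltis) => [p /Piso_null //|k|k p /prev[ps pnull]|a c p q].
- apply: null_vanishing => z; rewrite mevalB expr2 mevalM !mevalXU /shift_point.
  by rewrite /shift_ind; case: (_ == _); rewrite ?mulr1 ?mulr0 subrr.
- exact: null_mulX (degp _ ps) pnull.
- by move=> /prev[_ pnull] /prev[_ qnull]; apply: null_lin.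
Qed.

Lemma derivable_pexp p : pc_derivable n (@Piso F G H) p ->
  pexp sigma (fun z => p.@[shift_point z]) = 0.
Proof.
case=> s [der deg]; have := derivation_null der deg (p := p).
rewrite mem_rcons mem_head => /(_ isT 0); rewrite wt0 => /(_ isT) <-.
by apply: pexp_ext => z; rewrite chi0 mul1r.
Qed.

Lemma pexp1 : pexp sigma (fun=> 1) = 1.
Proof.
rewrite -[RHS]sigma0 -(pexp_chi two_neq0).
by apply: pexp_ext => z; rewrite chi0.
Qed.

Lemma not_pc_refutable : ~ pc_refutable n (@Piso F G H).
Proof.
move/derivable_pexp; rewrite (@pexp_ext _ _ _ _ (fun=> 1)) => [|z]; last first.
  exact: meval1.
by rewrite pexp1 => /eqP; rewrite oner_eq0.
Qed.

End Evaluation.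

(** The functional sends a derived [1 + \sum h ^ 2] to 0, but also to 1 plus a nonnegative
    number. *)
Lemma not_psatz_refutable (R : realType) r m (f : {ffun 'I_r * 'I_5 -> 'I_m})
    (b : 'cV['F_2]_r) K n : (0 < n)%N ->
    (forall u : 'rV_r, (wt u <= K + K)%N -> (wt u <= wt (u *m incmx f))%N) ->
    (10 * n + 10 + (10 * n + 10) <= K)%N ->
  ~ psatz_refutable n (@Piso R (cfi f 0) (cfi f b)).
Proof.
move=> n_gt0 expf leBK [hs der].
have two0 : 2%:R != 0 :> R by rewrite pnatr_eq0.
have pd := derivable_pexp two0 n_gt0 expf leBK der.
have {der} degp : ((msize (1 + \sum_(h <- hs) h ^+ 2)%R).-1 <= n)%N.
  case: der => s [_]; apply: leq_trans; apply: leq_pc_degree.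
  by rewrite mem_rcons mem_head.
move: pd; set sigma := pchi _ _ _ _.
rewrite (@pexp_ext _ _ _ _ (fun z => 1 + \sum_(h <- hs)
   h.@[@shift_point R _ _ f b z] * h.@[@shift_point R _ _ f b z])); last first.
  move=> z; rewrite mevalD meval1 raddf_sum /=; congr (1 + _).
  by apply: eq_bigr => h _; rewrite expr2 mevalM.
rewrite pexpD pexp_sum (pexp1 _ two0 expf) => /eqP; apply/negP.
rewrite gt_eqF // ltr_wpDr // big_seq sumr_ge0 // => h hs_h.
(* Squares cannot cancel, so the degree of [h] is at most half of [n] and its square has Fourier
   degree at most [5 n]. *)
have leh := leq_trans (sum_sqr_degree hs_h) degp.
apply: (@pexp_sqr_ge0 _ _ (10 * n + 10)%N _ _ _ (5 * (msize h).-1)).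
- exact: pchi0 expf.
- exact: pchiD expf leBK.
- by rewrite -mulnDr; move: (_ + _)%N leh => x; lia.
- exact: lowdeg_meval.
Qed.

(** * Choice of the parameters *)

Theorem theorem3 :
  exists c : nat, forall n : nat, (0 < n)%N ->
  exists G H : cgraph,
    [/\ ((2 <= #|G|)%N \/ (2 <= #|H|)%N),
        ((gsize G <= c * n)%N /\ (gsize H <= c * n)%N),
        ~ isomorphic G H,
        (forall F : fieldType, (2%N \notin [pchar F]) ->
           ~ pc_refutable n (@Piso F G H))
      & (forall R : realType, ~ psatz_refutable n (@Piso R G H))].
Proof.
(* The constant of [expander_exists], kept behind an equation so that the numeral is not
   unfolded. *)
have [c0 c0E c0_gt0] : exists2 c0, c0 = (4 * (8 * (64 * 9)))%N & (0 < c0)%N.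
  by exists (4 * (8 * (64 * 9)))%N.
(* With [r = m + 1] the size is at most [194 m + 192 <= 386 m], and [K + K = 40 n + 40 <= 80 n];
   both use positivity. *)
exists (386 * (c0 * 80))%N => n n_gt0.
(* [K] is twice the weight bound [10 n + 10], and expansion is wanted up to [K + K]. *)
pose K := (20 * n + 20)%N; pose m := (c0 * (K + K))%N.
have leKm : (K + K <= m)%N by rewrite leq_pmull.
have m_gt0 : (0 < m)%N by apply: leq_trans leKm; rewrite /K; lia.
have size_le : (386 * m <= 386 * (c0 * 80) * n)%N.
  have leK : (K + K <= 80 * n)%N by rewrite /K; lia.
  by rewrite /m -!mulnA !leq_mul2l leK !orbT.
have le_m1 : (m.+1 <= 2 * m)%N by rewrite mul2n -addnn -addn1 leq_add2l.
have le_c0 : (4 * (8 * (64 * 9)) * (K + K) <= m)%N by rewrite -c0E.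
have [f nbhdf] := expander_exists le_m1 m_gt0 le_c0 (leqW leKm).
have expf := wt_mul_incmx nbhdf.
have [b unsat] := unsolvable_rhs (incmx f).
have leBK : (10 * n + 10 + (10 * n + 10) <= K)%N by rewrite /K; lia.
exists (cfi f 0), (cfi f b).
have size_cfi c : (gsize (cfi f c) <= 386 * (c0 * 80) * n)%N.
  by apply: leq_trans size_le; apply: leq_trans (gsize_cfi _ _) _; lia.
split.
- by left; rewrite card_cfi; lia.
- by split; apply: size_cfi.
- by move/isomorphic_solvable => [z /unsat].
- move=> F; rewrite inE /= => two0; exact: not_pc_refutable expf leBK.
- by move=> R; apply: not_psatz_refutable expf leBK.
Qed.
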